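(* Let the time unit be $\tau_0=e^{E}$, so that $x_i=e^{E-E_i}$. For almost all $\underline{E}$, $$\lim_{E\downarrow-\infty}\frac{1}{N_E}\sum_{j=1}^{N_E}\delta_{\lambda_j^{(E)}}=\alpha x^{\alpha-1}\,dx\qquad\text{weakly in }\mathcal{M}([0,1]).$$
   Context: Fix $0<\alpha<1$. Let $\sum_i\delta_{E_i}$ be a Poisson point process on $\mathbb{R}$ with intensity measure $\alpha e^{-\alpha E}\,dE$; almost surely its support is infinite and bounded above, and its points are labelled in decreasing order $E_1>E_2>\cdots$; write $\underline{E}=(E_1,E_2,\dots)$. For $E\in\mathbb{R}$ let $N_E=\max\{i:E_i\ge E\}$ (so a.s. $1\le N_E<\infty$ for all sufficiently small $E$). For a time unit $\tau_0>0$ (here depending on $E$ as $\tau_0=e^E$) set $x_i:=\tau_0e^{-E_i}$. Let $\mathbb{L}_E$ be the $N_E\times N_E$ matrix with entries $(\mathbb{L}_E)_{ii}=\frac{(N_E-1)x_i}{N_E}$ and $(\mathbb{L}_E)_{ij}=-\frac{x_i}{N_E}$ for $i\ne j$. Almost surely, $\mathbb{L}_E$ has $N_E$ distinct real eigenvalues, denoted $0=\lambda_1^{(E)}<\lambda_2^{(E)}<\cdots<\lambda_{N_E}^{(E)}$. $\mathcal{M}([0,1])$ is the space of finite measures on $[0,1]$. *)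

(* Defs.v *)
From HB Require Import structures.
From mathcomp Require Import all_boot all_order all_algebra.
From mathcomp Require Import all_classical all_reals all_analysis.
From mathcomp Require Import measurable_realfun.
Set Implicit Arguments.
Unset Strict Implicit.
Unset Printing Implicit Defensive.
Import Order.TTheory GRing.Theory Num.Theory.
Import numFieldNormedType.Exports.
Local Open Scope classical_set_scope.
Local Open Scope ring_scope.

Section lebesgue_density.
Context (R : realType).
Local Open Scope ereal_scope.

(* The measure f(x) dx. The proof arguments are there only so that the measure
   instance below can be inferred; the measure lives on R rather than on
   measurableTypeR R, which has the same measurable sets but another display. *)
Definition lebesgue_density (f : R -> R) (mf : measurable_fun setT f)
    (f0 : forall x, (0 <= f x)%R) (A : set R) : \bar R :=
  \int[lebesgue_measure]_(x in A) (f x)%:E.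

Variables (f : R -> R) (mf : measurable_fun setT f).
Variable f0 : forall x, (0 <= f x)%R.

Let lebesgue_density_set0 : lebesgue_density mf f0 set0 = 0.
Proof. by rewrite /lebesgue_density integral_set0. Qed.

Let lebesgue_density_ge0 A : 0 <= lebesgue_density mf f0 A.
Proof. by apply: integral_ge0 => x _; rewrite lee_fin. Qed.

Let lebesgue_density_sigma_additive :
  semi_sigma_additive (lebesgue_density mf f0).
Proof.
apply: (@semi_sigma_additive_nng_induced _ (measurableTypeR R) R
  lebesgue_measure (EFin \o f)) => [|x]; last by rewrite lee_fin.
exact/measurable_EFinP.
Qed.

HB.instance Definition _ := isMeasure.Build _ R R (lebesgue_density mf f0)
  lebesgue_density_set0 lebesgue_density_ge0 lebesgue_density_sigma_additive.

End lebesgue_density.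

Section poisson_process.
Context d (T : measurableType d) d' (S : measurableType d') (R : realType).
Local Open Scope ereal_scope.

Definition mutually_independent (P : probability T R) k
    (X : 'I_k -> T -> \bar R) : Prop :=
  forall C : 'I_k -> set (\bar R), (forall i, measurable (C i)) ->
    P (\bigcap_i (X i @^-1` C i)) = \prod_(i < k) P (X i @^-1` C i).

Definition point_count (e : nat -> {mfun T >-> S}) (B : set S) (w : T)
    : \bar R :=
  \sum_(0 <= i <oo) \d_(e i w) B.

(* The random measure \sum_i \d_(e i) is a Poisson point process with intensity
   L; as usual, the Poisson law of infinite mean is the unit mass at +oo.
   The second argument of poisson_prob is a dummy, and poisson_prob, contrary to
   poisson_pmf, is the unit mass at 0 when the rate is 0. *)
Definition poisson_process (P : probability T R) (e : nat -> {mfun T >-> S})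
    (L : {measure set S -> \bar R}) : Prop :=
  [/\ forall B, measurable B -> L B < +oo -> forall k : nat,
        P [set w | point_count e B w = k%:R%:E] =
        poisson_prob (fine (L B)) 0%N [set k],
      forall B, measurable B -> L B = +oo ->
        P [set w | point_count e B w = +oo] = 1 &
      forall k (B : 'I_k -> set S), (forall i, measurable (B i)) ->
        trivIset setT B ->
        mutually_independent P (fun i => point_count e (B i))].

End poisson_process.

Section measures_on_R.
Context (R : realType).

Definition gumbel_density (alpha : R) (x : R) : R :=
  alpha * expR (- (alpha * x)).

Lemma measurable_gumbel_density alpha :
  measurable_fun setT (gumbel_density alpha).
Proof.
apply: measurable_funM => //; apply: measurableT_comp => //.
by apply: measurableT_comp => //; exact: measurable_funM.
Qed.

Lemma gumbel_density_ge0 alpha : 0 < alpha ->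
  forall x, 0 <= gumbel_density alpha x.
Proof. by move=> a0 x; rewrite mulr_ge0 ?expR_ge0// ltW. Qed.

Definition gumbel_intensity (alpha : R) (alpha_gt0 : 0 < alpha)
    : {measure set R -> \bar R} :=
  lebesgue_density (measurable_gumbel_density alpha)
    (gumbel_density_ge0 alpha_gt0).

Definition power_density (alpha : R) (x : R) : R :=
  alpha * x `^ (alpha - 1).

Lemma measurable_power_density alpha :
  measurable_fun setT (power_density alpha).
Proof. by apply: measurable_funM => //; exact: measurable_powR. Qed.

Lemma power_density_ge0 alpha : 0 < alpha ->
  forall x, 0 <= power_density alpha x.
Proof. by move=> a0 x; rewrite mulr_ge0 ?powR_ge0// ltW. Qed.

Definition power_law01 (alpha : R) (alpha_gt0 : 0 < alpha)
    : {measure set R -> \bar R} :=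
  mrestr (lebesgue_density (measurable_power_density alpha)
           (power_density_ge0 alpha_gt0))
         (measurable_itv `[0, 1]).

(* Finite measures on [0, 1] are represented by the finite measures on R that
   do not charge the complement of [0, 1]. *)
Definition on01 (m : {measure set R -> \bar R}) : Prop :=
  (m setT < +oo)%E /\ m (~` `[0, 1]) = 0%E.

Definition weak_cvg01 (F : set_system R) (m_ : R -> {measure set R -> \bar R})
    (m : {measure set R -> \bar R}) : Prop :=
  [/\ on01 m, \forall t \near F, on01 (m_ t) &
      forall f : R -> R, {within `[0, 1], continuous f} ->
        (\int[m_ t]_(x in `[0%R, 1%R]) (f x)%:E)%E @[t --> F] -->
        (\int[m]_(x in `[0%R, 1%R]) (f x)%:E)%E].

End measures_on_R.

Section trap_model.
Context (R : realType).
Implicit Types (e : nat -> R) (t tau : R).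

(* Indices are shifted by one: the i-th point E_i, i >= 1, is [e i.-1].
   The value is 0 when the maximum does not exist. *)
Definition num_above e t : nat :=
  let A := [set i.+1 | i in [set i | t <= e i]] in
  xget 0%N (A `&` ubound A).

Definition jump_rate tau e (i : nat) : R := tau * expR (- e i).

Definition generator (N : nat) tau e : 'M[R]_N :=
  \matrix_(i, j) if i == j then (N%:R - 1) * jump_rate tau e i / N%:R
                 else - (jump_rate tau e i / N%:R).

(* The real eigenvalues, without multiplicity, in increasing order. *)
Definition eigenvalues n (A : 'M[R]_n) : seq R :=
  xget [::] [set s : seq R | sorted <%R s /\
                             forall a, (a \in s) = eigenvalue A a].

(* Mass 1/n at each element of [eigenvalues A]: this has total mass 1 exactly
   when A has n distinct real eigenvalues. *)
Definition empirical_spectrum n (A : 'M[R]_n) : {measure set R -> \bar R} :=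
  mscale (n%:R^-1)%:nng
    (msum (fun j => dirac (eigenvalues A)`_j) (size (eigenvalues A))).

End trap_model.

(* Main.v *)
Require Import Defs.
From mathcomp Require Import all_boot all_order all_algebra.
From mathcomp Require Import all_classical all_reals all_analysis.
From mathcomp Require Import measurable_realfun polyrcf ring lra zify.
Import Order.TTheory GRing.Theory Num.Theory.
Import numFieldNormedType.Exports.
Local Open Scope classical_set_scope.
Local Open Scope ring_scope.

Set Implicit Arguments.
Unset Strict Implicit.

(** Write x_i for the jump rates and N_t for the number of points above t.

    The spectrum is pinned down by the rates.  The generator is
    diag(x) (1 - J/N) with J the all-ones matrix, so it has the eigenvalue 0,
    and every zero a of the secular function \sum_j 1/(x_j - a) is an eigenvalue
    with the explicit eigenvector 1/(x_j - a).  That function is minus the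
    logarithmic derivative of \prod_j ('X - x_j), so Rolle's theorem places one
    zero in each of the N - 1 gaps between consecutive rates; together with 0
    these are N eigenvalues, hence all of them ([eigenvalues_interlace]).  The
    distribution function of the empirical spectrum therefore differs from that
    of the empirical measure of the rates by at most 1/N
    ([eigenvalues_count]).

    The rates are counted by the point process.  With time unit e^t, a rate is
    at most y when the corresponding point lies above t - ln y, so that the
    proportion of rates below y is N_(t - ln y) / N_t.

    The counts obey a law of large numbers.  N_t is Poisson of mean
    e^(- alpha t).  Along the levels at which this mean is n + 1, a Chernoff bound
    is summable, and the Borel-Cantelli lemma gives N / (n + 1) -> 1 almost
    surely ([point_count_lln]); since N_t is monotone in t, this interpolates to
    N_t e^(alpha t) -> 1 as t -> -oo ([num_above_cvg]).  Hence
    N_(t - ln y) / N_t -> e^(alpha ln y) = y^alpha, which is the distribution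
    function of alpha x^(alpha - 1) dx.

    Finally, convergence of the distribution functions at every point of [0, 1]
    gives convergence of the integrals of continuous functions, by comparison
    with Riemann-Stieltjes sums ([cvg_integral01]). *)

(** * The spectrum of the generator *)

Lemma deriv_prod_root (R : rcfType) (s : seq R) (a : R) : a \notin s ->
  (\prod_(c <- s) ('X - c%:P))^`().[a] =
  (\prod_(c <- s) ('X - c%:P)).[a] * \sum_(c <- s) (a - c)^-1.
Proof.
elim: s => [|c s IHs]; first by rewrite !big_nil -polyC1 derivC horner0 mulr0.
rewrite inE negb_or => /andP[ac /IHs {}IHs].
rewrite !big_cons derivM !hornerE IHs derivXsubC hornerC mul1r.
have ac0 : a - c != 0 by rewrite subr_eq0.
by rewrite mulrDr mulrAC mulfV// mul1r mulrA.
Qed.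

(** Rolle's theorem for \prod_j ('X - x_j), which vanishes at both ends of the
    gap; its derivative at a point that is not a root vanishes together with the
    secular function. *)
Lemma secular_root (R : rcfType) (N : nat) (x : nat -> R) (k : nat) :
  {mono x : i j / (i < j)%N >-> i < j} -> (k.+1 < N)%N ->
  exists2 a, x k < a < x k.+1 & \sum_(j < N) (x j - a)^-1 = 0.
Proof.
move=> xlt kN.
pose s := [seq x j | j <- iota 0 N].
pose p := \prod_(c <- s) ('X - c%:P).
have rootp j : (j < N)%N -> p.[x j] = 0.
  move=> jN; apply/rootP; rewrite root_prod_XsubC.
  by apply: map_f; rewrite mem_iota.
have [||a] := @poly_rolle _ (x k) (x k.+1) p; first by rewrite xlt.
  by rewrite !rootp// ltnW.
rewrite in_itv/= => akk p'a.
have as_ : a \notin s.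
  apply/mapP => -[j _ aj]; move: akk; rewrite aj !xlt => /andP[kj].
  by rewrite ltnS leqNgt kj.
exists a => //; move: p'a; rewrite deriv_prod_root// => /eqP.
rewrite mulf_eq0 => /orP[|].
  by move=> pa0; move: as_; rewrite -root_prod_XsubC /root pa0.
rewrite big_map (_ : iota 0 N = index_iota 0 N) ?big_mkord; last first.
  by rewrite /index_iota subn0.
move=> /eqP s0.
apply/eqP; rewrite -oppr_eq0 -sumrN -[eqbRHS]s0; apply/eqP/eq_bigr => j _.
by rewrite -invrN opprB.
Qed.

Section generator_spectrum.
Variables (R : realType) (N : nat) (tau : R) (e : nat -> R).
Local Notation x := (jump_rate tau e).
Local Notation A := (generator N tau e).

(** The row vector with entries 1/(x_j - a) is an eigenvector.  The factor a in
    the last hypothesis makes the lemma cover the eigenvalue 0 as well, since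
    x_j/(x_j - a) = 1 + a/(x_j - a). *)
Lemma eigenvalue_generator (a : R) : (0 < N)%N ->
  (forall j : 'I_N, x j != a) -> a * \sum_(j < N) (x j - a)^-1 = 0 ->
  eigenvalue A a.
Proof.
move=> N0 xa sa; have Nn0 : N%:R != 0 :> R by rewrite pnatr_eq0 -lt0n.
have xa0 j : (j < N)%N -> x j - a != 0.
  by move=> jN; rewrite subr_eq0 (xa (Ordinal jN)).
apply/eigenvalueP; exists (\row_j (x j - a)^-1); last first.
  apply/eqP => /rowP /(_ (Ordinal N0)); rewrite !mxE => /eqP.
  by rewrite invr_eq0; apply/negP/xa0.
apply/rowP => j; rewrite !mxE.
have xE (i : 'I_N) : x i * (x i - a)^-1 = 1 + a * (x i - a)^-1.
  by rewrite -{1}(subrK a (x i)) mulrDl mulfV// xa0.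
have -> : \sum_i (\row_j (x j - a)^-1) 0 i * A i j =
    \sum_i ((if i == j then x i * (x i - a)^-1 else 0)
           - N%:R^-1 * (1 + a * (x i - a)^-1)).
  apply: eq_bigr => i _; rewrite !mxE -xE; case: (i == j).
    by field; rewrite Nn0 xa0.
  by field; rewrite Nn0 xa0.
rewrite sumrB -big_mkcond/= big_pred1_eq -mulr_sumr big_split/=.
rewrite sumr_const card_ord -mulr_sumr sa addr0 mulVf// xE.
by rewrite addrAC subrr add0r.
Qed.

Hypotheses (tau_gt0 : 0 < tau) (e_dec : forall i, e i.+1 < e i).

Lemma jump_rate_gt0 i : 0 < x i.
Proof. by rewrite mulr_gt0// expR_gt0. Qed.

Lemma jump_rate_mono : {mono x : i j / (i < j)%N >-> i < j}.
Proof.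
apply/leW_mono/le_mono => i j; apply: (homo_ltn lt_trans) => k.
by rewrite ltr_pM2l// ltr_expR ltrN2.
Qed.

(** The zeros found in the gaps, together with 0, are N distinct eigenvalues of
    an N x N matrix, and the characteristic polynomial leaves room for no
    other. *)
Lemma eigenvalues_interlace : (0 < N)%N ->
  [/\ size (eigenvalues A) = N, (eigenvalues A)`_0 = 0 &
   forall k, (k.+1 < N)%N -> x k < (eigenvalues A)`_k.+1 < x k.+1].
Proof.
move=> N0.
have /choice[l lP] k : exists a, (k.+1 < N)%N ->
    x k < a < x k.+1 /\ \sum_(j < N) (x j - a)^-1 = 0.
  case: (ltnP k.+1 N) => [kN|]; last by exists 0.
  by have [a ? ?] := secular_root jump_rate_mono kN; exists a.
pose lam k := if k is k'.+1 then l k' else 0.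
pose s := mkseq lam N.
have sE k : (k < N)%N -> s`_k = lam k by move=> kN; rewrite nth_mkseq.
have ss : sorted <%R s.
  apply/(sortedP 0) => k; rewrite size_mkseq => kN; rewrite !sE ?(ltnW kN)//.
  case: k kN => [|k] kN /=.
    have [/andP[+ _] _] := lP 0%N kN; exact/lt_trans/jump_rate_gt0.
  have [/andP[+ _] _] := lP k.+1 kN.
  by have [/andP[_ +] _] := lP k (ltnW kN); apply: lt_trans.
have us : uniq s by apply: lt_sorted_uniq.
have se a : a \in s -> eigenvalue A a.
  move=> /mapP[k]; rewrite mem_iota add0n/= => kN -> {a}.
  apply: eigenvalue_generator => //.
    move=> j; case: k kN => [|k] kN/=; first by rewrite gt_eqF// jump_rate_gt0.
    have [+ _] := lP k kN; apply: contraTneq => <-.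
    rewrite !jump_rate_mono; apply/negP => /andP[kj].
    by rewrite ltnS leqNgt kj.
  case: k kN => [|k] kN/=; first by rewrite mul0r.
  by have [_ ->] := lP k kN; rewrite mulr0.
have memsE a : (a \in s) = eigenvalue A a.
  apply/idP/idP => [/se//|ea].
  have pA0 : char_poly A != 0 by rewrite monic_neq0// char_poly_monic.
  apply: contraT => nas.
  have : (size (a :: s) < size (char_poly A))%N.
    apply: max_poly_roots => //=; last by rewrite nas.
    rewrite -eigenvalue_root_char ea/=; apply/allP => b /se.
    by rewrite eigenvalue_root_char.
  by rewrite size_char_poly/= size_mkseq ltnn.
have -> : eigenvalues A = s.
  rewrite /eigenvalues; case: xgetP => [s' _ [ss' s'E]|/(_ s)[]//].
  by apply: lt_sorted_eq => // a; rewrite s'E memsE.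
split; first by rewrite size_mkseq.
  by rewrite sE.
by move=> k kN; rewrite sE//; have [] := lP k kN.
Qed.

End generator_spectrum.

(** * Distribution function of the empirical spectrum *)

Lemma sum_ltn (n m : nat) : (\sum_(j < n) (j < m) = minn n m)%N.
Proof.
elim: n => [|n IHn]; first by rewrite big_ord0 min0n.
by rewrite big_ord_recr/= IHn; case: ltnP; lia.
Qed.

Lemma empirical_spectrumE (R : realType) n (A : 'M[R]_n) (U : set R) :
  empirical_spectrum A U = (n%:R^-1 *
    (\sum_(j < size (eigenvalues A)) (((eigenvalues A)`_j)%R \in U))%:R)%:E.
Proof.
rewrite /empirical_spectrum/= /mscale/= /msum EFinM; congr (_ * _)%E.
rewrite natr_sum -sumEFin.
by apply: eq_bigr => j _; rewrite /= diracE.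
Qed.

Section empirical.
Variables (R : realType) (N : nat) (tau : R) (e : nat -> R).
Hypotheses (tau_gt0 : 0 < tau) (e_dec : forall i, e i.+1 < e i).
Hypothesis N_gt0 : (0 < N)%N.
Local Notation x := (jump_rate tau e).
Local Notation A := (generator N tau e).

(** By interlacing, the eigenvalue of index j is below y when j < M, and above y
    when j > M; only the one of index M is undecided. *)
Lemma eigenvalues_count (M : nat) (y : R) : (M <= N)%N -> 0 <= y ->
  (forall i, (i < N)%N -> (x i <= y) = (i < M)%N) ->
  (M <= \sum_(j < size (eigenvalues A))
          (((eigenvalues A)`_j)%R \in `[0%R, y]%classic) <= M.+1)%N.
Proof.
move=> MN y0 xy; have [sN s0 sint] := eigenvalues_interlace tau_gt0 e_dec N_gt0.
have x0 i : 0 < x i by exact: jump_rate_gt0.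
rewrite sN; apply/andP; split.
  rewrite -[leqLHS](minn_idPr MN) -sum_ltn; apply: leq_sum => j _.
  case: ltnP => // jM; rewrite mem_setE in_itv/=.
  move: (ltn_ord j) (xy j (ltn_ord j)); rewrite jM.
  case: (nat_of_ord j) => [|k] kN xky; first by rewrite s0 lexx y0.
  have /andP[xk kx] := sint k kN.
  by rewrite (ltW (lt_trans (x0 _) xk)) (le_trans (ltW kx)).
rewrite (leq_trans _ (geq_minr N M.+1))// -sum_ltn; apply: leq_sum => j _.
case: ltnP => [_|Mj]; first exact: leq_b1.
rewrite mem_setE in_itv/=.
move: (ltn_ord j) Mj; case: (nat_of_ord j) => [|k] // kN Mk.
have /andP[xk _] := sint k kN.
rewrite [X in _ && X]leNgt (lt_trans _ xk) ?andbF//.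
by rewrite ltNge xy ?(ltnW kN)// -leqNgt.
Qed.

Lemma eigenvalues_01 (j : nat) : (forall i, (i < N)%N -> x i <= 1) ->
  (j < N)%N -> 0 <= (eigenvalues A)`_j <= 1.
Proof.
move=> x1 jN; have [sN s0 sint] := eigenvalues_interlace tau_gt0 e_dec N_gt0.
case: j jN => [|k] kN; first by rewrite s0 lexx ler01.
have /andP[xk kx] := sint k kN.
have xk0 := jump_rate_gt0 e tau_gt0 k.
by rewrite (ltW (lt_trans xk0 xk)) (le_trans (ltW kx))// x1.
Qed.

Lemma empirical_spectrum_on01 : (forall i, (i < N)%N -> x i <= 1) ->
  on01 (empirical_spectrum A).
Proof.
move=> x1; split; first by rewrite empirical_spectrumE ltry.
rewrite empirical_spectrumE big1 ?mulr0// => j _.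
apply/eqP; rewrite eqb0; apply/negP => /set_mem/=; apply.
have jN : (j < N)%N.
  have [sN _ _] := eigenvalues_interlace tau_gt0 e_dec N_gt0.
  by rewrite -[X in (_ < X)%N]sN.
by rewrite /= in_itv/= eigenvalues_01.
Qed.

End empirical.

(** * From distribution functions to integrals of continuous functions *)

Section weak_convergence.
Variable R : realType.
Implicit Types (f : R -> R) (m : {measure set R -> \bar R}).

(** Heine's theorem, through the covering form of compactness: continuity at x
    bounds the oscillation of f on a ball around x, uniformly over its points. *)
Lemma unif_continuous01 f (eps : R) :
  {within `[0, 1], continuous f} -> 0 < eps ->
  exists2 d : R, 0 < d & forall x y : R, x \in `[0, 1] -> y \in `[0, 1] ->
    `|x - y| < d -> `|f x - f y| < eps.
Proof.
move=> /subspace_continuousP cf eps0.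
have /compact_near_coveringP/near_covering_withinP cov := @segment_compact R 0 1.
have : \forall d \near (0:R)^'+, `[0, 1] `<=`
    (fun x : R => forall y : R, y \in `[0, 1] ->
      `|x - y| < d -> `|f x - f y| < eps).
  apply: (cov _ _ (fun d x => forall y : R, y \in `[0, 1] ->
    `|x - y| < d -> `|f x - f y| < eps)) => x x01.
  have eps20 : 0 < eps / 2 by rewrite divr_gt0.
  have /cvgrPdist_lt/(_ _ eps20) := cf x x01.
  rewrite near_withinE => /nbhs_ballP[r/= r0 fr].
  have r20 : 0 < r / 2 by rewrite divr_gt0.
  exists (ball x (r / 2), [set d | d < r / 2]).
    by split; [exact: nbhsx_ballx | exact: nbhs_right_lt].
  move=> [x' d]/= [xx' dr] x'01 y y01 x'y.
  rewrite /ball/= in xx'.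
  have xy : `|x - y| < r.
    by rewrite -(subrKA x') (le_lt_trans (ler_normD _ _))//; lra.
  have := fr x' (lt_trans xx' _) x'01; have := fr y xy y01.
  move=> fxy /(_ _)/wrap[]; first by lra.
  rewrite distrC => fxx'.
  by rewrite -(subrKA (f x)) (le_lt_trans (ler_normD _ _))//; lra.
move=> covd.
have [d [d0 fd]] := filter_ex (filterI (nbhs_right_gt (0 : R)) covd).
by exists d => // x y /fd; exact.
Qed.

Lemma integrable01 m f (x : R) : (m `[0%R, 1%R]%classic < +oo)%E ->
  {within `[0, 1], continuous f} -> x <= 1 ->
  m.-integrable `[0, x] (EFin \o f).
Proof.
move=> moo cf x1.
apply: (@integrableS _ _ _ m `[0, 1]) => //.
  by apply: subset_itvl; rewrite bnd_simp.
apply: measurable_bounded_integrable => //.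
- by apply: subspace_continuous_measurable_fun => //.
- have /compact_bounded[M [_ mrt]] :=
    continuous_compact cf (@segment_compact R 0 1).
  by exists M; split; rewrite ?num_real // => ? ? ? ?; exact: mrt.
Qed.

(** The intervals start at 0 because the measures of interest live on [0, 1]. *)
Definition cdf m (x : R) : R := fine (m `[0%R, x]%classic).

(** The first term is the contribution of a possible atom at 0; the others are
    the increments of F over the first n intervals of the subdivision of [0, 1]
    into K parts. *)
Definition stieltjes_sum f (F : R -> R) (K n : nat) : R :=
  f 0 * F 0 +
  \sum_(p < n) f (p%:R / K%:R) * (F (p.+1%:R / K%:R) - F (p%:R / K%:R)).

(** On each interval of the subdivision f stays within eps of its value at the
    left endpoint; the errors add up to eps times the mass. *)
Lemma stieltjes_sumP m f (K n : nat) (eps : R) :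
  (m `[0%R, 1%R]%classic < +oo)%E ->
  {within `[0, 1], continuous f} ->
  (forall x y : R, x \in `[0, 1] -> y \in `[0, 1] ->
    `|x - y| <= K%:R^-1 -> `|f x - f y| <= eps) ->
  (0 < K)%N -> (n <= K)%N -> 0 <= eps ->
  `|\int[m]_(x in `[0, n%:R / K%:R]) f x - stieltjes_sum f (cdf m) K n| <=
  eps * cdf m (n%:R / K%:R).
Proof.
move=> moo cf feps K0 + eps0; set F := cdf m.
have KR0 : 0 < K%:R :> R by rewrite ltr0n.
have u01 p : (p <= K)%N -> p%:R / K%:R \in `[(0:R), 1].
  by move=> pK; rewrite in_itv/= divr_ge0//= ler_pdivrMr// mul1r ler_nat.
have uS p : p%:R / K%:R < p.+1%:R / K%:R :> R.
  by rewrite ltr_pM2r ?invr_gt0// ltr_nat.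
have mfin (A : set R) : measurable A -> A `<=` `[0, 1] -> m A \is a fin_num.
  move=> mA A01; rewrite ge0_fin_numE// (le_lt_trans _ moo)//.
  by apply: le_measure; rewrite ?inE.
elim: n => [_|n IH nK].
  rewrite mul0r /stieltjes_sum big_ord0 addr0 set_itv1.
  rewrite (@eq_Rintegral _ _ _ _ _ (cst (f 0))); last first.
    by move=> x /set_mem/= ->.
  by rewrite Rintegral_cst// /F /cdf set_itv1 subrr normr0 mulr_ge0// fine_ge0//.
have {}IH := IH (ltnW nK).
set a := n%:R / K%:R in IH *; set b := n.+1%:R / K%:R.
have /andP[a0 a1] : 0 <= a <= 1 := u01 n (ltnW nK).
have /andP[b0 b1] : 0 <= b <= 1 := u01 n.+1 nK.
have ab : a < b := uS n.
have abE : `[0, b]%classic = `[0, a]%classic `|` `]a, b]%classic.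
  by rewrite -itv_bndbnd_setU// bnd_simp// ltW.
have dis : [disjoint `[0, a]%classic & `]a, b]%classic].
  apply/disj_setPS => x [] /=; rewrite !in_itv/= => /andP[_ xa] /andP[].
  by rewrite ltNge xa.
have FE : fine (m `]a, b]%classic) = F b - F a.
  rewrite /F /cdf abE measureU//; last by apply/eqP; rewrite -disj_set2E.
  rewrite fineD ?mfin//; first by rewrite addrAC subrr add0r.
  - by apply: subset_itvl; rewrite bnd_simp.
  - by apply: subset_itv; rewrite bnd_simp.
have if1 := integrable01 moo cf b1.
have if2 : m.-integrable `]a, b] (EFin \o f).
  by apply: integrableS if1 => //; rewrite abE; exact: subsetUr.
rewrite [in X in _ `|X - _|]abE Rintegral_setU//; last by rewrite -abE.
rewrite /stieltjes_sum big_ord_recr/= addrA -/(stieltjes_sum _ _ _ _) -/a -/b.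
have icst (c : R) : m.-integrable `]a, b] (EFin \o cst c).
  apply: measurable_bounded_integrable => //.
    rewrite -ge0_fin_numE// mfin//.
    by apply: subset_itv; rewrite bnd_simp.
  by exists `|c|; split; rewrite ?num_real// => ? ? ? ? /=; exact: ltW.
have Hab : `|\int[m]_(x in `]a, b]) f x - f a * (F b - F a)| <=
    eps * (F b - F a).
  rewrite -FE -!Rintegral_cst// -RintegralB//; last exact: icst.
  have ifB : m.-integrable `]a, b] (EFin \o (fun x => f x - f a)).
    under [X in _.-integrable _ X]eq_fun do rewrite /= EFinB.
    by apply: integrableB => //; exact: icst.
  apply: le_trans; first exact: le_normr_Rintegral.
  apply: le_Rintegral => //; [exact: (integrable_norm ifB) | exact: icst |].
  move=> x; rewrite /= in_itv/= => /andP[ax xb].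
  apply: feps; rewrite ?in_itv/= ?a0 ?a1//.
    by rewrite (le_trans a0 (ltW ax)) (le_trans xb b1).
  rewrite gtr0_norm ?subr_gt0// lerBlDr (le_trans xb)//.
  by rewrite /b -natr1 mulrDl mul1r addrC.
rewrite (_ : eps * F b = eps * F a + eps * (F b - F a)); last by ring.
apply: le_trans (lerD IH Hab); apply: le_trans (ler_normD _ _).
by rewrite le_eqVlt; apply/orP; left; apply/eqP; congr (`| _ |); ring.
Qed.

(** For a fixed subdivision, both integrals are within eps times the total mass of
    their Stieltjes sums, and a Stieltjes sum involves finitely many values of
    the distribution function. *)
Lemma cvg_integral01 (T : Type) (Fi : set_system T) (FF : Filter Fi)
    (m_ : T -> {measure set R -> \bar R}) m f :
  {within `[0, 1], continuous f} ->
  (m `[0%R, 1%R]%classic < +oo)%E ->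
  (\forall t \near Fi, (m_ t `[0%R, 1%R]%classic < +oo)%E) ->
  (forall x : R, 0 <= x <= 1 -> cdf (m_ t) x @[t --> Fi] --> cdf m x) ->
  (\int[m_ t]_(x in `[0%R, 1%R]) (f x)%:E)%E @[t --> Fi] -->
    (\int[m]_(x in `[0%R, 1%R]) (f x)%:E)%E.
Proof.
move=> cf moo m_oo cdfm.
have intE (mu : {measure set R -> \bar R}) : (mu `[0%R, 1%R]%classic < +oo)%E ->
    (\int[mu]_(x in `[0%R, 1%R]) (f x)%:E)%E =
    (\int[mu]_(x in `[0, 1]) f x)%:E.
  move=> muoo; rewrite fineK//.
  by apply: integrable_fin_num => //; exact: (integrable01 muoo cf (lexx _)).
rewrite intE//.
apply: (@cvg_trans _ ((\int[m_ t]_(x in `[0, 1]) f x)%:E @[t --> Fi])).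
  apply: near_eq_cvg; apply: filterS m_oo => t mt.
  by rewrite intE.
apply: cvg_EFin; first exact: nearW.
apply/cvgrPdist_le => /= eps eps0.
(* The three errors are at most eps / B times cdf m 1, cdf m 1 + 1 and 1. *)
pose B := 2 * cdf m 1 + 2.
have cdf1 : 0 <= cdf m 1 by rewrite fine_ge0.
have B0 : 0 < B by rewrite /B; lra.
have e0 : 0 < eps / B by rewrite divr_gt0.
have [d d0 fd] := unif_continuous01 cf e0.
pose K := (Num.truncn d^-1).+1.
have KR0 : 0 < K%:R :> R by rewrite ltr0n.
have Kd : K%:R^-1 < d by rewrite invf_plt ?posrE// truncnS_gt.
have fK (x y : R) : x \in `[0, 1] -> y \in `[0, 1] ->
    `|x - y| <= K%:R^-1 -> `|f x - f y| <= eps / B.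
  by move=> x01 y01 xy; rewrite ltW// fd// (le_lt_trans xy).
have S (mu : {measure set R -> \bar R}) : (mu `[0%R, 1%R]%classic < +oo)%E ->
    `|\int[mu]_(x in `[0, 1]) f x - stieltjes_sum f (cdf mu) K K| <=
    eps / B * cdf mu 1.
  move=> muoo.
  have := stieltjes_sumP muoo cf fK isT (leqnn _) (ltW e0).
  by rewrite divff// gt_eqF.
have u01 p : (p <= K)%N -> 0 <= p%:R / K%:R <= (1 : R).
  by move=> pK; rewrite divr_ge0//= ler_pdivrMr// mul1r ler_nat.
have cS : stieltjes_sum f (cdf (m_ t)) K K @[t --> Fi] -->
    stieltjes_sum f (cdf m) K K.
  apply: cvgD; first by apply: cvgMr; apply: cdfm; rewrite lexx ler01.
  apply: cvg_big => [|p _]; first exact: add_continuous.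
  apply: cvgMr; apply: cvgB; apply: cdfm; apply: u01 => //.
  exact: ltnW.
have cdfm1 : cdf (m_ t) 1 @[t --> Fi] --> cdf m 1.
  by apply: cdfm; rewrite ler01 lexx.
near=> t.
have mt : (m_ t `[0%R, 1%R]%classic < +oo)%E by near: t.
have H1 := S _ moo; have H2 := S _ mt.
have H3 : `|stieltjes_sum f (cdf m) K K - stieltjes_sum f (cdf (m_ t)) K K| <=
    eps / B.
  by near: t; move/cvgrPdist_le : cS; apply.
have H4 : `|cdf m 1 - cdf (m_ t) 1| <= 1.
  by near: t; move/cvgrPdist_le : cdfm1; apply.
have H5 : eps / B * cdf (m_ t) 1 <= eps / B * (cdf m 1 + 1).
  rewrite ler_pM2l//; move: H4; rewrite ler_norml => /andP[H4 _].
  by rewrite -lerBlDl -lerN2 opprB.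
have H6 : eps = eps / B * cdf m 1 + eps / B * (cdf m 1 + 1) + eps / B.
  rewrite -mulrDr -[X in _ + X]mulr1 -mulrDr.
  by rewrite (_ : _ + _ = B) ?divfK ?gt_eqF// /B; ring.
rewrite [leRHS]H6 /=.
move: H1 H2 H3; rewrite !ler_norml => /andP[? ?] /andP[? ?] /andP[? ?].
by apply/andP; split; lra.
Unshelve. all: by end_near. Qed.

End weak_convergence.

(** * Concentration of Poisson variables *)

Section poisson_tail.
Variable R : realType.

Lemma expR_le_quad (s : R) : s <= 2^-1 -> expR s - 1 - s <= 2 * s ^+ 2.
Proof.
move=> s2; have s1 : 0 < 1 - s by lra.
have : expR s <= (1 - s)^-1.
  rewrite -[expR s]invrK -expRN lef_pV2 ?posrE ?expR_gt0//.
  by have := expR_ge1Dx (- s).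
suff : (1 - s)^-1 <= 1 + s + 2 * s ^+ 2 by lra.
rewrite -[leLHS]mul1r ler_pdivrMr//.
have -> : (1 + s + 2 * s ^+ 2) * (1 - s) = 1 + s ^+ 2 * (1 - 2 * s) by ring.
by rewrite lerDl mulr_ge0 ?sqr_ge0//; lra.
Qed.

(** An exponential tilt of a Poisson law is again a Poisson law. *)
Lemma poisson_pmf_tilt (r s : R) k : 0 < r ->
  poisson_pmf r k * expR (s * (k%:R - r)) =
  poisson_pmf (r * expR s) k * expR (r * (expR s - 1 - s)).
Proof.
move=> r0; rewrite /poisson_pmf r0 mulr_gt0 ?expR_gt0// exprMn -expRM_natr.
have H : expR (- r) * expR (s * (k%:R - r)) = expR (s * k%:R) *
    expR (- (r * expR s)) * expR (r * (expR s - 1 - s)).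
  by rewrite -!expRD; congr expR; ring.
by rewrite -mulrA H; ring.
Qed.

(** Chernoff's bound; negative s gives the lower tail.  The tilted law has total
    mass 1, which replaces the computation of the exponential moment. *)
Lemma poisson_prob_chernoff (r s c : R) (U : set nat) : 0 < r ->
  (forall k, U k -> c <= s * (k%:R - r)) ->
  (poisson_prob r 0 U <= (expR (r * (expR s - 1 - s) - c))%:E)%E.
Proof.
move=> r0 Uc; have rs0 : 0 < r * expR s by rewrite mulr_gt0 ?expR_gt0.
have tot : (\esum_(k in [set: nat]) (poisson_pmf (r * expR s) k)%:E = 1)%E.
  transitivity (poisson_prob (r * expR s) 0 [set: nat]).
    by rewrite /poisson_prob rs0.
  exact: probability_setT.
rewrite -[leRHS]mule1 -tot /poisson_prob r0.
rewrite -nneseries_esumT => [|k]; last by rewrite lee_fin poisson_pmf_ge0.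
rewrite -nneseriesZl => [|k _]; last by rewrite lee_fin poisson_pmf_ge0.
have ge0 k : (0 <= (expR (r * (expR s - 1 - s) - c))%:E *
    (poisson_pmf (r * expR s) k)%:E)%E.
  by rewrite mule_ge0 ?lee_fin ?expR_ge0 ?poisson_pmf_ge0.
rewrite nneseries_esumT// [leLHS]esum_mkcond; apply: le_esum => k _.
case: ifPn => // /set_mem/Uc ck; rewrite -EFinM lee_fin expRD mulrC mulrA.
rewrite -poisson_pmf_tilt// -mulrA -expRD ler_peMr ?poisson_pmf_ge0//.
by rewrite -[leLHS]expR0 ler_expR subr_ge0.
Qed.

Lemma poisson_concentration (r eps : R) : 0 < r -> 0 < eps <= 2 ->
  (poisson_prob r 0 [set k | (eps * r <= `|k%:R - r|)%R] <=
   (2 * expR (- (r * eps ^+ 2 / 8)))%:E)%E.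
Proof.
move=> r0 /andP[eps0 eps2].
(* With e^s - 1 - s <= 2 s^2, the exponent r (2 s^2) - r |s| eps is minimal at
   |s| = eps / 4. *)
have tail (s : R) : s <= 2^-1 -> 8 * s ^+ 2 = eps ^+ 2 / 2 ->
    (poisson_prob r 0 [set k | (eps ^+ 2 / 4 * r <= s * (k%:R - r))%R] <=
     (expR (- (r * eps ^+ 2 / 8)))%:E)%E.
  move=> s2 se; apply: le_trans.
    by apply: (@poisson_prob_chernoff r s (eps ^+ 2 / 4 * r)) => // k.
  rewrite lee_fin ler_expR.
  rewrite [leRHS](_ : _ = r * (eps ^+ 2 / 8) - eps ^+ 2 / 4 * r); last by field.
  rewrite lerB// ler_pM2l// (le_trans (expR_le_quad _))//; lra.
rewrite (_ : 2 * _ = expR (- (r * eps ^+ 2 / 8)) + expR (- (r * eps ^+ 2 / 8)));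
  last by ring.
rewrite EFinD.
apply: le_trans (leeD (tail (eps / 4) _ _) (tail (- (eps / 4)) _ _)); first last.
- by field.
- lra.
- by field.
- lra.
apply: (le_trans _ (measureU2 _ _ _)) => //.
apply: le_measure; rewrite ?inE// => k /=.
have -> : eps ^+ 2 / 4 * r = eps / 4 * (eps * r) by field.
case: ger0P => _ kr; [left|right] => /=.
  by rewrite ler_pM2l ?divr_gt0.
by rewrite mulNr -mulrN ler_pM2l ?divr_gt0.
Qed.

End poisson_tail.

(** * Law of large numbers for a Poisson point process *)

Section poisson_point_process.
Context d (T : measurableType d) (R : realType) (P : probability T R).
Context d' (S : measurableType d') (e : nat -> {mfun T >-> S}).
Variable L : {measure set S -> \bar R}.
Hypothesis eL : poisson_process P e L.

Lemma measurable_point_count (B : set S) (k : nat) : measurable B ->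
  measurable [set w | point_count R e B w = k%:R%:E].
Proof.
move=> mB; rewrite -[X in measurable X]setTI.
have mc : measurable_fun setT (point_count R e B).
  apply: ge0_emeasurable_sum => // n _.
  exact: (measurableT_comp (measurable_fun_dirac mB) (measurable_funPT (e n))).
exact: (mc measurableT _ (emeasurable_set1 _)).
Qed.

(** This event asserts in particular that the count is finite. *)
Definition count_near (B : set S) (r eps : R) : set T :=
  [set w | exists2 k : nat,
             point_count R e B w = k%:R%:E & `|k%:R - r| < eps * r].

Lemma count_nearE B r eps : count_near B r eps =
  \bigcup_(k in [set k : nat | `|k%:R - r| < eps * r])
    [set w | point_count R e B w = k%:R%:E].
Proof. by apply/seteqP; split=> w /= [k]; exists k. Qed.

Lemma measurable_count_near B r eps : measurable B ->
  measurable (count_near B r eps).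
Proof.
move=> mB; rewrite count_nearE; apply: bigcup_measurable => k _.
exact: measurable_point_count.
Qed.

Lemma point_count_concentration B (r eps : R) : measurable B -> L B = r%:E ->
  0 < r -> 0 < eps <= 2 ->
  (P (~` count_near B r eps) <= (2 * expR (- (r * eps ^+ 2 / 8)))%:E)%E.
Proof.
move=> mB LB r0 eps02; have [eL1 _ _] := eL.
apply: (le_trans _ (poisson_concentration r0 eps02)).
set D := [set k : nat | `|k%:R - r| < eps * r].
rewrite (_ : mkset _ = ~` D); last first.
  by apply/seteqP; split => k /=; rewrite leNgt => /negP.
rewrite !probability_setC//; last exact: measurable_count_near.
suff -> : P (count_near B r eps) = poisson_prob r 0 D by [].
rewrite count_nearE measure_bigcup; last 2 first.
- by move=> k _; exact: measurable_point_count.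
- by move=> i j _ _ [w /= [->]] [] /eqP; rewrite eqr_nat => /eqP.
have -> : poisson_prob r 0 D = poisson_prob r 0 (\bigcup_(k in D) [set k]).
  by rewrite bigcup_imset1 image_id.
rewrite measure_bigcup//; last by move=> i j _ _ [w /= [-> ->]].
apply: eq_eseriesr => k _.
by have := eL1 B mB; rewrite LB; apply; exact: ltry.
Qed.

(** Borel-Cantelli: the bounds of [point_count_concentration] form a geometric
    series in n. *)
Lemma point_count_lln (B : nat -> set S) : (forall n, measurable (B n)) ->
  (forall n, L (B n) = n.+1%:R%:E) ->
  {ae P, forall w, forall j : nat, \forall n \near \oo,
    count_near (B n) n.+1%:R j.+1%:R^-1 w}.
Proof.
move=> mB LB; apply/ae_foralln => j; set eps : R := j.+1%:R^-1.
have eps0 : 0 < eps by rewrite invr_gt0 ltr0n.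
have eps02 : 0 < eps <= 2.
  by rewrite eps0/= (@le_trans _ _ 1)// ?ler1n// invf_le1 ?ler1n ?ltr0n.
pose A n := ~` count_near (B n) n.+1%:R eps.
have mA n : measurable (A n) by apply/measurableC/measurable_count_near.
exists (lim_sup_set A); split.
- apply: bigcap_measurable => // n _; exact: bigcup_measurable.
- apply: lim_sup_set_cvg0 => //.
  pose q := expR (- (eps ^+ 2 / 8)).
  have q1 : `|q| < 1.
    by rewrite ger0_norm ?expR_ge0// expR_lt1 oppr_lt0 divr_gt0 ?exprn_gt0.
  apply: (@le_lt_trans _ _ (\sum_(n <oo) (geometric (2 * q) q n)%:E)%E).
    apply: lee_nneseries => // n _.
    apply: le_trans (point_count_concentration (mB n) (LB n) _ eps02) _ => //.
    rewrite lee_fin /geometric/= -[leRHS]mulrA -exprS /q -expRM_natl.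
    by rewrite le_eqVlt; apply/orP; left; apply/eqP; congr (_ * expR _); field.
  have -> : (\sum_(n <oo) (geometric (2 * q) q n)%:E)%E =
      (limn (series (geometric (2 * q) q)))%:E.
    rewrite -EFin_lim; last exact: is_cvg_geometric_series.
    by apply/congr_lim/funext => n/=; rewrite /series/= -sumEFin.
  exact: ltry.
- move=> w /= nw; apply: contrapT => nA; apply: nw.
  move: nA; rewrite /lim_sup_set /bigcap/= => /existsNP[n /not_implyP[_ nA]].
  by exists n => // k nk; apply: contrapT => kA; apply: nA; exists k.
Qed.

End poisson_point_process.

(** * The intensity of the points and the limit law *)

Section intensities.
Variables (R : realType) (alpha : R) (alpha_gt0 : 0 < alpha).

Lemma is_derive_gumbel (x : R) :
  is_derive x 1 (fun x => - expR (- (alpha * x))) (gumbel_density alpha x).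
Proof.
apply: is_derive_eq.
by rewrite [_%:A]mulr1 /gumbel_density mulrN opprK mulrC.
Qed.

Lemma continuous_expRNM : continuous (fun x : R => expR (- (alpha * x))).
Proof.
move=> x; apply: (@continuous_comp _ _ _ (fun z : R => - (alpha * z)) expR).
  by apply: cvgN; apply: cvgMr; exact: cvg_id.
exact: continuous_expR.
Qed.

Lemma gumbel_intensity_tail (t : R) :
  gumbel_intensity alpha_gt0 `[t, +oo[%classic = (expR (- (alpha * t)))%:E.
Proof.
rewrite /gumbel_intensity/= /Defs.lebesgue_density.
rewrite (@ge0_continuous_FTC2y _ _ (fun x => - expR (- (alpha * x))) _ 0).
- by rewrite sub0e EFinN oppeK.
- by move=> x _; exact: gumbel_density_ge0.
- apply: continuous_subspaceT => x.
  by apply: cvgMr; exact: continuous_expRNM.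
- rewrite -[X in _ --> X]oppr0; apply: cvgN.
  rewrite (_ : (fun x => _) = (fun z => expR (- z)) \o (fun z => alpha * z))//.
  apply: (@cvg_comp _ _ _ _ _ _ (pinfty_nbhs R)); last exact: cvgr_expR.
  exact: gt0_cvgMry.
- by move=> x _; case: (is_derive_gumbel x).
- by apply: cvg_at_right_filter; apply: cvgN; exact: continuous_expRNM.
- by move=> x _; rewrite derive1E; case: (is_derive_gumbel x).
Qed.

Lemma continuous_powR (x : R) p : 0 < x ->
  {for x, continuous (fun x => x `^ p)}.
Proof.
move=> x0; apply: differentiable_continuous; apply/derivable1_diffP.
by apply: derivable_powR; rewrite in_itv/= x0.
Qed.

Lemma power_density_FTC (a b : R) : 0 < a -> a < b ->
  (\int[lebesgue_measure]_(x in `[a, b]) (power_density alpha x)%:E =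
   (b `^ alpha - a `^ alpha)%:E)%E.
Proof.
move=> a0 ab.
rewrite (@continuous_FTC2 _ _ (fun x => x `^ alpha)) //.
- apply: continuous_in_subspaceT => x /set_mem.
  rewrite /= in_itv/= => /andP[ax _].
  by apply: cvgMr; apply: continuous_powR; exact: lt_le_trans ax.
- split.
  + move=> x; rewrite in_itv/= => /andP[ax _]; apply: derivable_powR.
    by rewrite in_itv/= (lt_trans a0 ax).
  + by apply: cvg_at_right_filter; exact: continuous_powR.
  + by apply: cvg_at_left_filter; apply: continuous_powR; exact: lt_trans ab.
- move=> x; rewrite in_itv/= => /andP[ax _].
  have x0 := lt_trans a0 ax.
  by rewrite powR_derive1// in_itv/= x0.
Qed.

(** The density may be unbounded at 0, so the fundamental theorem of calculus is
    applied on [x / (n + 2), x], and these intervals increase to ]0, x]. *)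
Lemma power_law01_cdf (x : R) : 0 <= x <= 1 ->
  power_law01 alpha_gt0 `[0, x]%classic = (x `^ alpha)%:E.
Proof.
move=> /andP[x0 x1].
rewrite /power_law01/= /mrestr setIidl; last first.
  by apply: subset_itvl; rewrite bnd_simp.
pose mu : {measure set R -> \bar R} := Defs.lebesgue_density
  (measurable_power_density alpha) (power_density_ge0 alpha_gt0).
have m0 : mu [set 0] = 0%E.
  by rewrite /mu/= /Defs.lebesgue_density integral_set1.
move: x0; rewrite le_eqVlt => /predU1P[<-|x0].
  by rewrite set_itv1 powR0 ?gt_eqF.
have -> : `[0, x]%classic = [set 0] `|` `]0, x]%classic.
  by rewrite setU1itv ?bnd_simp ?ltW.
rewrite (measureU mu)//=; last first.
  by apply/seteqP; split => y //= [->]; rewrite in_itv/= ltxx.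
rewrite m0 add0e.
pose A n := `[x / n.+2%:R, x]%classic.
have AE : `]0, x]%classic = \bigcup_n A n.
  apply/seteqP; split => y /=.
    rewrite in_itv/= => /andP[y0 yx].
    exists (Num.truncn (x / y)) => //; rewrite /A/= in_itv/= yx andbT.
    rewrite ler_pdivrMr ?ltr0n// mulrC -ler_pdivrMr//.
    by rewrite ltW// (lt_le_trans (truncnS_gt _))// ler_nat.
  move=> [n _]; rewrite /A/= !in_itv/= => /andP[+ ->]; rewrite andbT.
  by apply: lt_le_trans; rewrite divr_gt0.
have : (mu \o A) n @[n --> \oo] --> mu `]0, x]%classic.
  rewrite AE; apply: nondecreasing_cvg_mu => //.
  - by move=> n; exact: measurable_itv.
  - by apply: bigcup_measurable => n _; exact: measurable_itv.
  - move=> m n mn; apply/subsetPset => y.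
    rewrite /A/= !in_itv/= => /andP[my ->].
    rewrite andbT (le_trans _ my)// ler_pM2l// lef_pV2 ?posrE ?ltr0n//.
    by rewrite ler_nat !ltnS.
move=> /cvg_lim <-//; apply/cvg_lim => //.
rewrite (_ : _ \o _ =
    fun n => (x `^ alpha - (x / n.+2%:R) `^ alpha)%:E); last first.
  apply/funext => n /=; rewrite /Defs.lebesgue_density power_density_FTC//.
    by rewrite divr_gt0// ltr0n.
  by rewrite ltr_pdivrMr ?ltr0n// ltr_pMr// ltr1n.
apply: cvg_EFin; first exact: nearW.
rewrite -[X in _ --> X]subr0; apply: cvgB; first exact: cvg_cst.
rewrite /comp/=.
have h0 : x / n.+2%:R @[n --> \oo] --> (0 : R).
  rewrite -[X in _ --> X](mulr0 x); apply: cvgMr.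
  by have := @cvg_harmonic R; rewrite -cvg_shiftS.
have h : x / n.+2%:R @[n --> \oo] --> 0^'+.
  move=> U U0; have : \forall n \near \oo, 0 < x / n.+2%:R -> U (x / n.+2%:R).
    exact: h0 U0.
  by apply: filterS => n; apply; rewrite divr_gt0.
exact: (cvg_comp _ _ h (powR_cvg0 alpha_gt0)).
Qed.

Lemma power_law01_on01 : on01 (power_law01 alpha_gt0).
Proof.
split.
  have := @power_law01_cdf 1; rewrite ler01 lexx => /(_ isT).
  by rewrite /power_law01/= /mrestr setTI setIid => ->; exact: ltry.
by rewrite /power_law01/= /mrestr setICl /Defs.lebesgue_density integral_set0.
Qed.

End intensities.

(** * The number of points above a level *)

Section counting.
Variables (R : realType) (e : nat -> R).
Hypothesis e_dec : forall i, e i.+1 < e i.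

Lemma num_above_unique (t : R) (k : nat) :
  (forall i, (t <= e i) = (i < k)%N) -> num_above e t = k.
Proof.
move=> tk; rewrite /num_above; set A := [set _ | _ in _].
have Ak : ubound A k by move=> _ [i /= + <-]; rewrite tk.
case: xgetP => [n _ [[i /=]]|nA].
  rewrite tk => ik <- ubi; apply/eqP; rewrite eqn_leq ik/=.
  case: k tk ik {Ak} => // k tk _; apply: ubi.
  by exists k => //=; rewrite tk.
case: k tk Ak => // k tk Ak; exfalso; apply: (nA k.+1); split => //.
by exists k => //=; rewrite tk.
Qed.

Lemma num_aboveP (t : R) : (exists i, e i < t) ->
  forall i, (t <= e i) = (i < num_above e t)%N.
Proof.
move=> ex; have [k ekt kmin] := ex_minnP ex.
have tk i : (t <= e i) = (i < k)%N.
  apply/idP/idP => [tei|ik]; last first.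
    by rewrite leNgt; apply/negP => /kmin; rewrite leqNgt ik.
  rewrite ltnNge; apply/negP => ki.
  have nincr : {homo e : n m / (n <= m)%N >-> m <= n}.
    by apply/nonincreasing_seqP => j; exact: ltW.
  by have /(le_trans tei) := nincr _ _ ki; rewrite leNgt ekt.
by move=> i; rewrite (num_above_unique tk).
Qed.

Lemma num_above_nincr (t u : R) : (exists i, e i < t) -> t <= u ->
  (num_above e u <= num_above e t)%N.
Proof.
move=> ext tu; have exu : exists i, e i < u.
  by have [i eit] := ext; exists i; exact: lt_le_trans tu.
rewrite leqNgt -num_aboveP// -ltNge (@lt_le_trans _ _ t)//.
by rewrite ltNge num_aboveP// ltnn.
Qed.

(** A finite count forces the decreasing sequence to go below t: otherwise all
    its terms would be counted. *)
Lemma point_count_num_above (t : R) (k : nat) :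
  (\sum_(0 <= i <oo) \d_(e i) `[t, +oo[%classic = k%:R%:E :> \bar R)%E ->
  (exists i, e i < t) /\ num_above e t = k.
Proof.
have diE i : \d_(e i) `[t, +oo[%classic = (t <= e i)%R%:R%:E :> \bar R.
  by rewrite diracE mem_setE in_itv/= andbT.
under eq_eseriesr do rewrite diE.
move=> sumk; have ext : exists i, e i < t.
  apply: contrapT => /forallNP nex.
  have : (\sum_(0 <= i < k.+1) (t <= e i)%R%:R%:E <= k%:R%:E :> \bar R)%E.
    by rewrite -sumk; apply: nneseries_lim_ge => // n _ _; rewrite lee_fin.
  rewrite sumEFin lee_fin -natr_sum ler_nat.
  rewrite (eq_bigr (fun=> 1%N)) => [|i _].
    by rewrite sum_nat_const_nat subn0 muln1 ltnn.
  by have /negP := nex i; rewrite -leNgt => ->.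
split => //; apply/eqP; rewrite -(eqr_nat R); apply/eqP.
apply: EFin_inj; rewrite -sumk; apply/esym/cvg_lim => //.
apply: cvg_near_cst; exists (num_above e t) => // n /= tn.
rewrite sumEFin -natr_sum big_mkord; congr (_%:R%:E).
under eq_bigr do rewrite num_aboveP//.
by rewrite sum_ltn; apply/minn_idPr.
Qed.

End counting.

Section asymptotics.
Variables (R : realType) (alpha : R) (e : nat -> R).
Hypotheses (alpha_gt0 : 0 < alpha) (e_dec : forall i, e i.+1 < e i).

(** The level above which the expected number of points is n + 1. *)
Definition quantile_level (n : nat) : R := - (ln n.+1%:R / alpha).

Hypothesis e_lln : forall j : nat, \forall n \near \oo,
  exists2 k : nat,
    (\sum_(0 <= i <oo) \d_(e i) `[quantile_level n, +oo[%classic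
       = k%:R%:E :> \bar R)%E &
    `|k%:R - n.+1%:R| < j.+1%:R^-1 * n.+1%:R :> R.

Lemma level_le (n : nat) (t : R) :
  (quantile_level n <= t) = (expR (- (alpha * t)) <= n.+1%:R).
Proof.
rewrite /quantile_level lerNl ler_pdivlMr// mulNr (mulrC t).
by rewrite -[in LHS](expRK (- (alpha * t))) ler_ln// posrE ?expR_gt0.
Qed.

Lemma level_ge (n : nat) (t : R) :
  (t <= quantile_level n) = (n.+1%:R <= expR (- (alpha * t))).
Proof.
rewrite /quantile_level lerNr ler_pdivrMr// mulNr (mulrC t).
by rewrite -[in LHS](expRK (- (alpha * t))) ler_ln// posrE ?expR_gt0.
Qed.

Lemma below_any_level (t : R) : exists i, e i < t.
Proof.
have [n0 _ n0P] := e_lln 0.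
pose n := maxn n0 (Num.truncn (expR (- (alpha * t)))).
have [k /(point_count_num_above e_dec)[[i ei] _] _] := n0P n (leq_maxl _ _).
exists i; rewrite (lt_le_trans ei)// level_le.
by rewrite ltW// (lt_le_trans (truncnS_gt _))// ler_nat ltnS leq_maxr.
Qed.

Lemma num_aboveE (t : R) i : (t <= e i) = (i < num_above e t)%N.
Proof. exact: num_aboveP (below_any_level t) i. Qed.

(** Let n + 1 be the integer part of v = e^(- alpha t).  Then t lies between the
    levels of index n + 1 and n, so monotonicity puts N_t between two counts
    which are within a factor 1 +- del of n + 1 and n + 2, and hence within
    3 del v of v once del (n + 1) >= 1. *)
Lemma num_above_cvg :
  (num_above e t)%:R * expR (alpha * t) @[t --> -oo] --> (1 : R).
Proof.
apply/cvgrPdist_le => eps eps0.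
pose j := Num.truncn (3 / eps); pose del : R := j.+1%:R^-1.
have del0 : 0 < del by rewrite invr_gt0 ltr0n.
have deleps : 3 * del <= eps.
  rewrite /del ler_pdivrMr ?ltr0n// -ler_pdivrMl// mulrC.
  by rewrite ltW// truncnS_gt.
have [n0 _ n0P] := e_lln j.
near=> t.
set v := expR (- (alpha * t)); set N := num_above e t.
have v0 : 0 < v by exact: expR_gt0.
have vM : (n0 + j).+2%:R <= v.
  by rewrite /v -level_ge; near: t; exact/nbhs_ninfty_le/num_real.
have [n nv vn] : exists2 n : nat, (n.+1%:R <= v) & v < n.+2%:R.
  have : (0 < Num.truncn v)%N by rewrite truncn_gt0 (le_trans _ vM)// ler1n.
  by case: (Num.truncn v) (truncn_itv (ltW v0)) => // n /andP[? ?] _; exists n.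
have n0jn : (n0 + j <= n)%N.
  by rewrite -(ler_nat R); move: vM vn; rewrite -!natr1; lra.
have [k /(point_count_num_above e_dec)[_ kE] kn] :=
  n0P n (leq_trans (leq_addr _ _) n0jn).
have [k' /(point_count_num_above e_dec)[_ k'E] k'n] :=
  n0P n.+1 (leq_trans (leq_addr _ _) (leqW n0jn)).
have kN : (k <= N)%N.
  rewrite -kE; apply: num_above_nincr => //; first exact: below_any_level.
  by rewrite level_ge.
have Nk' : (N <= k')%N.
  rewrite -k'E; apply: num_above_nincr => //; first exact: below_any_level.
  by rewrite level_le ltW.
have ivE : expR (alpha * t) = v^-1 by rewrite /v expRN invrK.
have dn1 : 1 <= del * n.+1%:R.
  rewrite mulrC ler_pdivlMr ?ltr0n// mul1r ler_nat ltnS.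
  exact: leq_trans (leq_addl _ _) n0jn.
have dnv : del * n.+1%:R <= del * v by rewrite ler_pM2l.
have dv : del <= del * v.
  by rewrite ler_peMr ?(ltW del0)// (le_trans _ nv)// ler1n.
have H : `|v - N%:R| <= 3 * del * v.
  have kNR : k%:R <= N%:R :> R by rewrite ler_nat.
  have Nk'R : N%:R <= k'%:R :> R by rewrite ler_nat.
  move: kn k'n; rewrite -/del !ltr_norml => /andP[k1 k2] /andP[k3 k4].
  rewrite -(natr1 n.+1) mulrDr mulr1 in k4; rewrite -(natr1 n.+1) in vn k4.
  by rewrite ler_norml; apply/andP; split; lra.
rewrite ivE -(@ler_pM2r _ v)// -[X in _ * X <= _](gtr0_norm v0).
rewrite -normrM mulrBl mul1r.
by rewrite divfK ?gt_eqF// (le_trans H)// ler_pM2r.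
Unshelve. all: by end_near. Qed.

Lemma num_above_gt0 : \forall t \near -oo, (0 < num_above e t)%N.
Proof.
have /cvgr_gt /(_ 0 ltr01) := num_above_cvg; apply: filterS => t.
by rewrite lt0n; apply: contraTneq => ->; rewrite mul0r ltxx.
Qed.

Lemma num_above_inv_cvg0 : (num_above e t)%:R^-1 @[t --> -oo] --> (0 : R).
Proof.
have ev0 : expR (alpha * t) @[t --> -oo] --> (0 : R).
  rewrite (_ : (fun t => _) =
      (fun z => expR (- z)) \o (fun t => - (alpha * t))); last first.
    by apply/funext => t /=; rewrite opprK.
  apply: (@cvg_comp _ _ _ (fun t => - (alpha * t)) (fun z => expR (- z)) -oo +oo).
    by apply/cvgNry; apply: gt0_cvgMrNy => //; exact: cvg_id.
  exact: cvgr_expR.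
have cv : expR (alpha * t) * ((num_above e t)%:R * expR (alpha * t))^-1
    @[t --> -oo] --> (0 * 1^-1 : R).
  exact: cvgM ev0 (cvgV (@oner_neq0 R) num_above_cvg).
rewrite mul0r in cv; apply: cvg_trans cv; apply: near_eq_cvg; near=> t.
by rewrite /= invfM mulrCA mulfV ?mulr1// gt_eqF// expR_gt0.
Unshelve. all: by end_near. Qed.

Lemma num_above_ratio_cvg (x : R) : 0 < x ->
  (num_above e (t - ln x))%:R / (num_above e t)%:R @[t --> -oo] --> x `^ alpha.
Proof.
move=> x0.
have shift : t - ln x @[t --> -oo] --> -oo.
  apply/cvgrNyPle => A; near=> t; rewrite lerBlDr.
  by near: t; exact/nbhs_ninfty_le/num_real.
have cv : (num_above e (t - ln x))%:R * expR (alpha * (t - ln x)) * x `^ alpha *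
    ((num_above e t)%:R * expR (alpha * t))^-1
    @[t --> -oo] --> (1 * x `^ alpha * 1^-1 : R).
  exact: cvgM (cvgM (cvg_comp _ _ shift num_above_cvg) (cvg_cst (x `^ alpha)))
    (cvgV (@oner_neq0 R) num_above_cvg).
rewrite invr1 mulr1 mul1r in cv; apply: cvg_trans cv.
apply: near_eq_cvg; near=> t.
rewrite /= /powR gt_eqF//= invfM mulrBr expRB.
(* As an atom, the inverse of N_t cancels without any condition on N_t. *)
by set iN := (num_above e t)%:R^-1; field; rewrite !gt_eqF ?expR_gt0.
Unshelve. all: by end_near. Qed.

(** * Convergence of the empirical spectrum *)

Local Notation mu t :=
  (empirical_spectrum (generator (num_above e t) (expR t) e)).

Lemma jump_rate_le (t y : R) i : 0 < y ->
  (jump_rate (expR t) e i <= y) = (t - ln y <= e i).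
Proof.
move=> y0; rewrite /jump_rate -expRD -[X in _ <= X](lnK y0) ler_expR.
by rewrite lerBlDr lerBlDl addrC.
Qed.

Lemma jump_rate_count (t y : R) i : 0 <= y ->
  (jump_rate (expR t) e i <= y) =
  (i < if (y == 0)%R then 0 else num_above e (t - ln y))%N.
Proof.
rewrite le_eqVlt => /predU1P[<-|y0].
  by rewrite eqxx ltn0; apply/negbTE; rewrite -ltNge jump_rate_gt0// expR_gt0.
by rewrite gt_eqF// jump_rate_le// num_aboveE.
Qed.

Lemma empirical_spectrum_weak_cvg :
  weak_cvg01 -oo (fun t => mu t) (power_law01 alpha_gt0).
Proof.
have Ngt0 := num_above_gt0.
have on : \forall t \near -oo, on01 (mu t).
  apply: filterS Ngt0 => t N0; apply: empirical_spectrum_on01 => //.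
    exact: expR_gt0.
  by move=> i iN; rewrite jump_rate_le// ln1 subr0 num_aboveE.
split => //; first exact: power_law01_on01.
move=> f cf; apply: cvg_integral01 => //.
- by rewrite power_law01_cdf ?ler01 ?lexx// ltry.
- apply: filterS on => t [mT _]; apply: le_lt_trans mT.
  by apply: le_measure; rewrite ?inE.
move=> y /andP[y0 y1].
pose M t := if y == 0 then 0%N else num_above e (t - ln y).
have Mcvg : (M t)%:R / (num_above e t)%:R @[t --> -oo] --> y `^ alpha.
  rewrite /M; move: y0; rewrite le_eqVlt => /predU1P[<-|y0].
    rewrite eqxx powR0 ?gt_eqF//.
    by under eq_fun do rewrite mul0r; exact: cvg_cst.
  by rewrite gt_eqF//; exact: num_above_ratio_cvg.
have -> : cdf (power_law01 alpha_gt0) y = y `^ alpha.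
  by rewrite /cdf power_law01_cdf ?y0.
apply: (@squeeze_cvgr _ _ _ _ (fun t => (M t)%:R / (num_above e t)%:R)
  (fun t => (M t)%:R / (num_above e t)%:R + (num_above e t)%:R^-1)) => //;
  last first.
  by rewrite -[X in _ --> X]addr0; apply: cvgD => //; exact: num_above_inv_cvg0.
apply: filterS Ngt0 => t N0.
have MN : (M t <= num_above e t)%N.
  rewrite /M; case: eqP => // y_neq0.
  apply: num_above_nincr => //; first exact: below_any_level.
  by rewrite lerBrDr gerDl ln_le0.
have /andP[] := eigenvalues_count (expR_gt0 t) e_dec N0 MN y0
  (fun i _ => jump_rate_count t i y0).
rewrite /cdf empirical_spectrumE/=; set c := (\sum_(_ < _) _)%N => Mc cM.
rewrite -[X in _ + X]mul1r -mulrDl natr1 (mulrC _^-1).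
by rewrite !ler_pM2r ?invr_gt0 ?ltr0n// !ler_nat Mc cM.
Qed.

End asymptotics.

Theorem proposition4p3 (R : realType) (alpha : R)
  (alpha_gt0 : 0 < alpha) (alpha_lt1 : alpha < 1)
  (d : measure_display) (Omega : measurableType d) (P : probability Omega R)
  (E : nat -> {RV P >-> R})
  (E_poisson : poisson_process P E (gumbel_intensity alpha_gt0))
  (E_decreasing : {ae P, forall w, forall i, E i.+1 w < E i w}) :
  {ae P, forall w,
    let e := fun i => E i w in
    weak_cvg01 -oo
      (fun t => empirical_spectrum (generator (num_above e t) (expR t) e))
      (power_law01 alpha_gt0)}.
Proof.
pose B n := `[quantile_level alpha n, +oo[%classic.
have LB n : gumbel_intensity alpha_gt0 (B n) = n.+1%:R%:E.
  rewrite gumbel_intensity_tail /quantile_level mulrN opprK.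
  by rewrite mulrCA mulfV ?gt_eqF// mulr1 lnK// posrE.
have mB n : measurable (B n) by exact: measurable_itv.
apply: filterS2 E_decreasing (point_count_lln E_poisson mB LB) => w e_dec e_lln.
exact: empirical_spectrum_weak_cvg e_dec e_lln.
Qed.
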